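(* Let $X$ be a compact metric space and let $T\colon X\to X$ be a continuous map satisfying the Closing Lemma and having a point with dense orbit. Let $(g_n)_{n\in\mathbb{N}}$ be an almost additive sequence (with respect to $T$) of continuous functions $g_n\colon X\to\mathbb{R}$ with bounded variation. Then the following are equivalent: 1. $\lim_{n\to\infty}\|g_n\|_\infty/n=0$; 2. $\sup_{n\in\mathbb{N}}\|g_n\|_\infty<\infty$; 3. there exists $K>0$ such that $|g_n(p)|\le K$ for all $p\in X$ and $n\in\mathbb{N}$ with $T^n(p)=p$.
   Context: $\mathbb{N}=\{1,2,\dots\}$, $d$ is the metric of $X$, and $\|\cdot\|_\infty$ is the supremum norm. Closing Lemma: $T$ satisfies the Closing Lemma if for every $\varepsilon>0$ there exists $\delta>0$ such that whenever $x\in X$ and $n\in\mathbb{N}$ satisfy $d(T^n(x),x)<\delta$, there exists $y\in X$ with $T^n(y)=y$ and $d(T^k(x),T^k(y))<\varepsilon$ for all $0\le k<n$. A point $x$ has dense orbit (is transitive) if $\overline{\{T^n(x):n\in\mathbb{N}\}}=X$. Almost additive: $(g_n)_{n\in\mathbb N}$ is almost additive with respect to $T$ if there is $C>0$ with $-C+g_m(x)+g_n(T^m(x))\le g_{m+n}(x)\le g_m(x)+g_n(T^m(x))+C$ for all $x\in X$ and $m,n\ge1$. Bounded variation: $(g_n)_{n\in\mathbb N}$ has bounded variation if there is $\varepsilon>0$ such that $\sup_{n\in\mathbb{N}}\sup\{|g_n(x)-g_n(y)|: d_n(x,y)<\varepsilon\}<\infty$, where $d_n(x,y)=\max\{d(T^k(x),T^k(y)):0\le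 k\le n-1\}$. *)

(* Defs.v *)
From mathcomp Require Import all_boot all_order all_algebra.
From mathcomp Require Import all_classical all_reals all_analysis.

Set Implicit Arguments.
Unset Strict Implicit.
Unset Printing Implicit Defensive.

Import Order.TTheory GRing.Theory Num.Theory.
Import numFieldNormedType.Exports.

Local Open Scope classical_set_scope.
Local Open Scope ring_scope.

(* Time indices range over {1, 2, ...}.  Sequences g_1, g_2, ... are indexed by
   nat, and the value at index 0 is unconstrained and never used. *)

Definition closing_lemma (R : realType) (X : metricType R) (T : X -> X) : Prop :=
  forall e : R, 0 < e -> exists2 delta : R, 0 < delta &
    forall (x : X) (n : nat), (0 < n)%N -> mdist (iter n T x) x < delta ->
      exists2 y : X, iter n T y = y &
        forall k : nat, (k < n)%N -> mdist (iter k T x) (iter k T y) < e.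

Definition has_dense_orbit (X : topologicalType) (T : X -> X) (x : X) : Prop :=
  closure [set iter n T x | n in [set n : nat | (0 < n)%N]] = setT.

Definition almost_additive (R : realType) (X : Type) (T : X -> X)
    (g : nat -> X -> R) : Prop :=
  exists2 C : R, 0 < C &
    forall (x : X) (m n : nat), (0 < m)%N -> (0 < n)%N ->
      - C + g m x + g n (iter m T x) <= g (m + n)%N x /\
      g (m + n)%N x <= g m x + g n (iter m T x) + C.

(* Distances being nonnegative, the default value 0 of the iterated maximum
   does not affect it when 0 < n. *)
Definition bowen_dist (R : realType) (X : metricType R) (T : X -> X) (n : nat)
    (x y : X) : R :=
  \big[Num.max/0]_(k < n) mdist (iter k T x) (iter k T y).

Definition bounded_variation_seq (R : realType) (X : metricType R) (T : X -> X)
    (g : nat -> X -> R) : Prop :=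
  exists2 e : R, 0 < e &
    (ereal_sup
      [set ereal_sup [set `|g n p.1 - g n p.2|%:E
                      | p in [set p : X * X | bowen_dist T n p.1 p.2 < e]%R]
       | n in [set n : nat | (0 < n)%N]] < +oo)%E.

(* Extended-real valued, so that no boundedness is presupposed (the value is
   -oo on an empty domain). *)
Definition sup_norm (R : realType) (X : Type) (f : X -> R) : \bar R :=
  ereal_sup [set `|f x|%:E | x in [set: X]].

(* Main.v *)
(** By almost additivity, [g_(k n)] differs from [k g_n] by at most [k C] at a
    point of period [n], so sublinear growth forces [`|g_n p| <= C] there.
    Conversely let [x] have dense orbit and suppose [g] is bounded on periodic
    points. Finitely many orbit points [T^k x], [k < N], are [delta]-dense. For
    [n >= N] the point [T^n x] is [delta]-close to one of them, so the orbit
    segment from [T^k x] to [T^n x] is shadowed by a periodic one, and bounded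
    variation bounds [g_(n - k) (T^k x)]. Hence [g_n x] is bounded in [n], then
    so is [g_n (T^m x)] in [m] and [n], and by density so is [g_n]. *)
Require Import Defs.
From mathcomp Require Import all_boot all_order all_algebra.
From mathcomp Require Import all_classical all_reals all_analysis.
From mathcomp Require Import lra.

Set Implicit Arguments.
Unset Strict Implicit.
Unset Printing Implicit Defensive.

Import Order.TTheory GRing.Theory Num.Theory.
Import numFieldNormedType.Exports.

Local Open Scope classical_set_scope.
Local Open Scope ring_scope.

Lemma sup_norm_leP (R : realType) (X : Type) (f : X -> R) (M : R) :
  (sup_norm f <= M%:E)%E <-> forall x, `|f x| <= M.
Proof.
split=> [fM x|fM].
  rewrite -lee_fin; apply: le_trans fM.
  by apply: ereal_sup_ubound; exists x.
by apply: ge_ereal_sup => _ [x _ <-]; rewrite lee_fin.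
Qed.

Lemma sup_norm_ge0 (R : realType) (X : Type) (f : X -> R) (x : X) :
  (0 <= sup_norm f)%E.
Proof. by apply: le_ereal_sup_tmp; exists `|f x|%:E; [exists x | rewrite lee_fin]. Qed.

Lemma ereal_sup_lty (R : realType) (S : set (\bar R)) :
  (ereal_sup S < +oo)%E -> exists2 M : R, 0 < M & ubound S M%:E.
Proof.
have ubS := ereal_sup_ubound (S := S).
case: (ereal_sup S) ubS => [r| |] ubS // _.
  exists (`|r| + 1) => [|y /ubS yr]; first by rewrite ltr_pwDr.
  apply: le_trans yr _; rewrite lee_fin; have := ler_norm r; lra.
(* The supremum is [-oo] here, so any positive constant will do. *)
by exists 1 => // y /ubS /le_trans; apply; rewrite leNye.
Qed.

Lemma ereal_sup_sup_norm_ltyP (R : realType) (X : Type) (g : nat -> X -> R) :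
  (ereal_sup [set sup_norm (g n) | n in [set n : nat | (0 < n)%N]] < +oo)%E <->
  exists2 K : R, 0 < K & forall n x, (0 < n)%N -> `|g n x| <= K.
Proof.
split=> [/ereal_sup_lty[K K0 gK]|[K K0 gK]].
  exists K => // n x n0; move: x; apply/sup_norm_leP; apply: gK.
  by exists n.
apply: le_lt_trans (ltry K); apply: ge_ereal_sup => _ [n /= n0 <-].
by apply/sup_norm_leP => x; exact: gK.
Qed.

Lemma bounded_variation_seqP (R : realType) (X : metricType R) (T : X -> X)
    (g : nat -> X -> R) :
  bounded_variation_seq T g ->
  exists2 e : R, 0 < e & exists2 M : R, 0 < M & forall n x y, (0 < n)%N ->
    (forall k, (k < n)%N -> mdist (iter k T x) (iter k T y) < e) ->
    `|g n x - g n y| <= M.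
Proof.
move=> [e e0 /ereal_sup_lty[M M0 gM]]; exists e => //; exists M => // n x y n0 xy.
rewrite -lee_fin; apply: le_trans (gM _ (ex_intro2 _ _ n n0 erefl)).
apply: ereal_sup_ubound; exists (x, y) => //=.
(* The default value 0 of the maximum must also lie below [e]; this is [e0]. *)
by apply: bigmax_lt => // k _; apply: xy.
Qed.

Lemma almost_additive_norm (R : realType) (X : Type) (T : X -> X)
    (g : nat -> X -> R) :
  almost_additive T g ->
  exists2 C : R, 0 < C & forall x m n, (0 < m)%N -> (0 < n)%N ->
    `|g (m + n)%N x - (g m x + g n (iter m T x))| <= C.
Proof.
move=> [C C0 gC]; exists C => // x m n m0 n0.
by have [? ?] := gC x m n m0 n0; rewrite ler_norml; apply/andP; split; lra.
Qed.

Lemma iter_periodic (X : Type) (T : X -> X) (p : X) (n k : nat) :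
  iter n T p = p -> iter (k * n) T p = p.
Proof. by move=> Tp; elim: k => // k IH; rewrite mulSn iterD IH Tp. Qed.

(** Cutting [k.+1] periods into single ones takes [k] cuts, each costing at most [C]; every piece
    starts at [p] again by periodicity. *)
Lemma almost_additive_periodic (R : realType) (X : Type) (T : X -> X)
    (g : nat -> X -> R) (C : R) (p : X) (n k : nat) :
  (forall x m n, (0 < m)%N -> (0 < n)%N ->
    `|g (m + n)%N x - (g m x + g n (iter m T x))| <= C) ->
  (0 < n)%N -> iter n T p = p ->
  `|g (k.+1 * n)%N p - k.+1%:R * g n p| <= k%:R * C.
Proof.
move=> gC n0 Tp; elim: k => [|k IH]; first by rewrite mul1n mul1r subrr normr0 mul0r.
have := gC p (k.+1 * n)%N n; rewrite muln_gt0 n0 iter_periodic// => /(_ isT isT).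
rewrite [(k.+2 * n)%N]mulSn addnC -[in k.+2%:R]addn1 natrD mulrDl mul1r.
move: IH; rewrite -(addn1 k) !natrD mulrDl mul1r.
by rewrite !ler_norml => /andP[? ?] /andP[? ?]; apply/andP; split; lra.
Qed.

Lemma sublinear_periodic_bound (R : realType) (X : Type) (T : X -> X)
    (g : nat -> X -> R) :
  almost_additive T g ->
  (sup_norm (g n) * (n%:R^-1)%:E)%E @[n --> \oo] --> (0 : \bar R)%E ->
  exists2 K : R, 0 < K &
    forall (p : X) (n : nat), (0 < n)%N -> iter n T p = p -> `|g n p| <= K.
Proof.
move=> /almost_additive_norm[C C0 gC] g0; exists C => // p n n0 Tp.
have nR0 : 0 < n%:R :> R by rewrite ltr0n.
apply/ler_addgt0Pr => e e0.
(* The threshold [e / n] is chosen so that over [N.+1] periods [g] is at most [N.+1 * e] in absolute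
   value; dividing by [N.+1] then leaves [C + e]. *)
have [|N _ gN] := g0 [set y | (y < (e / n%:R)%:E)%E].
  by apply: (@nbhs_open_ereal_lt _ 0 (fun=> e / n%:R)); rewrite divr_gt0.
have m0 : (0 < N.+1 * n)%N by rewrite muln_gt0 n0.
have mR0 : 0 < (N.+1 * n)%:R :> R by rewrite ltr0n.
have /= := gN (N.+1 * n)%N (leq_trans (leqnSn N) (leq_pmulr _ n0)).
rewrite muleC lte_pdivrMl// -EFinM [_ * (e / _)]mulrC => /ltW /sup_norm_leP /(_ p).
rewrite natrM mulrCA divfK ?gt_eqF// => gle.
have gkn := almost_additive_periodic N gC n0 Tp.
have k0 : 0 < N.+1%:R :> R by rewrite ltr0n.
rewrite -(ler_pM2l k0) -[X in X * `|_|]gtr0_norm// -normrM -[_ * g n p](subKr (g (N.+1 * n)%N p)).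
apply: le_trans (ler_normB _ _) _; move: gle gkn; rewrite -addn1 natrD => gle gkn.
by lra.
Qed.

Lemma dense_orbit_net (R : realType) (X : metricType R) (T : X -> X) (x : X) (d : R) :
  compact [set: X] -> has_dense_orbit T x -> 0 < d ->
  exists N, forall y, exists k, [/\ (0 < k)%N, (k < N)%N & mdist y (iter k T x) < d].
Proof.
move=> /compact_near_coveringP cX xT d0.
have [|N _ XN] := cX nat \oo (fun N y => exists k,
  [/\ (0 < k)%N, (k < N)%N & mdist y (iter k T x) < d]) _.
  move=> y _.
  have : closure [set iter n T x | n in [set n : nat | (0 < n)%N]] y by rewrite xT.
  have /[swap]/[apply] : nbhs y (ball y (d / 2)) by apply: nbhsx_ballx; rewrite divr_gt0.
  move=> [_ [[k k0 <-] yk]].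
  (* One orbit point within [d / 2] of [y] serves the whole ball around [y] and every [N > k];
     compactness then makes [N] uniform. *)
  exists (ball y (d / 2), [set N | (k < N)%N]).
    by split=> /=; [apply: nbhsx_ballx; rewrite divr_gt0 | exact: nbhs_infty_gt].
  move=> [z N] /= [yz kN]; exists k; split => //.
  by have := ball_splitr yk yz; rewrite ballEmdist /= metric_sym.
by exists N => y; apply: (XN N) => /=.
Qed.

(** The closing lemma, used at the scale [e] of bounded variation, gives a shadowing periodic point:
    [K] bounds [g] there and [M] the change. *)
Lemma almost_closed_bound (R : realType) (X : metricType R) (T : X -> X)
    (g : nat -> X -> R) (K : R) :
  closing_lemma T -> bounded_variation_seq T g ->
  (forall p n, (0 < n)%N -> iter n T p = p -> `|g n p| <= K) ->
  exists2 d : R, 0 < d & exists L : R, forall x n, (0 < n)%N ->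
    mdist (iter n T x) x < d -> `|g n x| <= L.
Proof.
move=> closT /bounded_variation_seqP[e e0 [M M0 gM]] gK.
have [d d0 dT] := closT e e0; exists d => //; exists (M + K) => x n n0 xd.
have [y Ty xy] := dT x n n0 xd.
rewrite -[g n x](subrK (g n y)); apply: le_trans (ler_normD _ _) _.
by apply: lerD; [exact: gM | exact: gK].
Qed.

Lemma dense_orbit_bound (R : realType) (X : metricType R) (T : X -> X)
    (g : nat -> X -> R) (K : R) (x : X) :
  compact [set: X] -> closing_lemma T -> has_dense_orbit T x ->
  almost_additive T g -> bounded_variation_seq T g ->
  (forall p n, (0 < n)%N -> iter n T p = p -> `|g n p| <= K) ->
  exists B : R, forall n, (0 < n)%N -> `|g n x| <= B.
Proof.
move=> cX closT xT /almost_additive_norm[C C0 gC] bvg gK.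
have [d d0 [L gL]] := almost_closed_bound closT bvg gK.
have [N xN] := dense_orbit_net cX xT d0.
pose A := \big[Num.max/0]_(k < N) `|g k x|.
have gA k : (k < N)%N -> `|g k x| <= A.
  by move=> kN; exact: (le_bigmax _ (fun k : 'I_N => `|g k x|) (Ordinal kN)).
(* [A] bounds the head up to time [k], [L] the almost closed segment after it, and [C] the error of
   the splitting. The absolute value keeps the bound above [A] when [n < N]. *)
exists (A + `|L| + C) => n n0; have [nN|Nn] := ltnP n N.
  by have := gA n nN; have := normr_ge0 L; lra.
have [k [k0 kN nk]] := xN (iter n T x).
have kn : (k < n)%N := leq_trans kN Nn.
have nk0 : (0 < n - k)%N by rewrite subn_gt0.
have := gL (iter k T x) (n - k)%N nk0; rewrite -iterD subnK ?(ltnW kn)// => /(_ nk).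
have := gC x k (n - k)%N k0 nk0; rewrite subnKC ?(ltnW kn)//.
have := gA k kN; have := ler_norm L.
rewrite !ler_norml => ? /andP[? ?] /andP[? ?] /andP[? ?]; apply/andP; split; lra.
Qed.

Lemma uniform_bound (R : realType) (X : metricType R) (T : X -> X)
    (g : nat -> X -> R) (K : R) :
  compact [set: X] -> closing_lemma T -> (exists x, has_dense_orbit T x) ->
  (forall n, (0 < n)%N -> continuous (g n)) ->
  almost_additive T g -> bounded_variation_seq T g ->
  (forall p n, (0 < n)%N -> iter n T p = p -> `|g n p| <= K) ->
  exists2 B : R, 0 < B & forall n x, (0 < n)%N -> `|g n x| <= B.
Proof.
move=> cX closT [x xT] contg addg bvg gK.
have [B gB] := dense_orbit_bound cX closT xT addg bvg gK.
have [C C0 gC] := almost_additive_norm addg.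
have B0 : 0 <= B by apply: le_trans (gB 1%N isT).
(* Along the orbit, [g n (iter m T x)] is [g (m + n) x - g m x] up to [C]. The bound passes to the
   closure because it defines a closed set. *)
exists (B + B + C) => [|n y n0]; first lra.
suff : [set: X] `<=` [set z | `|g n z| <= B + B + C] by apply.
rewrite -xT; apply: (@subset_trans _ (closure [set z | `|g n z| <= B + B + C])).
  apply: closureS => _ [m m0 <-] /=.
  have := gC x m n m0 n0; have := gB m m0; have := gB (m + n)%N; rewrite addn_gt0 m0.
  move=> /(_ isT); rewrite !ler_norml => /andP[? ?] /andP[? ?] /andP[? ?].
  by apply/andP; split; lra.
rewrite -(closure_id _).1 //.
apply: (@preimage_closed _ _ (fun z => `|g n z|) [set r | r <= B + B + C]).
  by move=> z _; apply: cvg_norm; exact: contg.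
exact: closed_le.
Qed.

(** The point [x] makes the domain nonempty, so that [sup_norm] is nonnegative and can be squeezed
    between 0 and [K]. *)
Lemma bounded_sublinear (R : realType) (X : Type) (g : nat -> X -> R) (K : R) (x : X) :
  (forall n x, (0 < n)%N -> `|g n x| <= K) ->
  (sup_norm (g n) * (n%:R^-1)%:E)%E @[n --> \oo] --> (0 : \bar R)%E.
Proof.
move=> gK; apply: (@squeeze_cvge _ _ _ _ (cst 0%E) _ (fun n => (K * n%:R^-1)%:E)).
- near=> n; apply/andP; split.
    by rewrite mule_ge0 ?sup_norm_ge0// lee_fin invr_ge0.
  rewrite EFinM; apply: lee_wpmul2r; first by rewrite lee_fin invr_ge0.
  apply/sup_norm_leP => y; apply: gK; near: n; exact: nbhs_infty_gt.
- exact: cvg_cst.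
(* The shift turns [n^-1] into the harmonic sequence, which is indexed as [n.+1^-1]. *)
- rewrite -cvg_shiftS -[0%E]/((0 : R)%:E) -(mulr0 K); apply: cvg_EFin; first by near=> n.
  by apply: cvgM; [exact: cvg_cst | exact: cvg_harmonic].
Unshelve. all: by end_near.
Qed.

Theorem theorem5 (R : realType) (X : metricType R) (T : X -> X)
    (g : nat -> X -> R)
    (compactX : compact [set: X])
    (contT : continuous T)
    (closingT : closing_lemma T)
    (transT : exists x : X, has_dense_orbit T x)
    (contg : forall n : nat, (0 < n)%N -> continuous (g n))
    (addg : almost_additive T g)
    (bvg : bounded_variation_seq T g) :
  [<-> (sup_norm (g n) * (n%:R^-1)%:E)%E @[n --> \oo] --> (0 : \bar R)%E;
       (ereal_sup [set sup_norm (g n) | n in [set n : nat | (0 < n)%N]] < +oo)%E;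
       exists2 K : R, 0 < K &
         forall (p : X) (n : nat), (0 < n)%N -> iter n T p = p -> `|g n p| <= K].
Proof.
(* The cycle is 1 to 2 to 3 to 1. The first and last arrows both rest on [uniform_bound], the first
   after passing from 1 to 3. *)
tfae=> [/(sublinear_periodic_bound addg)[K _ gK]|/ereal_sup_sup_norm_ltyP[K K0 gK]|[K _ gK]].
- by apply/ereal_sup_sup_norm_ltyP; apply: (uniform_bound compactX closingT transT contg addg bvg gK).
- by exists K => // p n n0 _; exact: gK.
- have [x _] := transT.
  have [B _ gB] := uniform_bound compactX closingT transT contg addg bvg gK.
  exact: bounded_sublinear x gB.
Qed.
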